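(* Fix $\rho>0$. For every $\varepsilon>0$ there exists $\beta_0=\beta_0(\rho,\varepsilon)>0$ such that for all $\beta\ge\beta_0$ the following holds: for every deterministic $\rho$-finite-precision tournament-based voting rule $f$ there exists an election instance with $m=3$ candidates and utilities in $[0,1]$ (a probability distribution $\mathcal{V}$ on $[0,1]^3$) on which the distortion of $f$ under the Plackett–Luce model with parameter $\beta$ is at least $\left(\frac58-\varepsilon\right)\beta$, i.e. $$\limsup_{n\to\infty}\frac{\max_{j\in C}\mathrm{Util}_j}{\mathrm{Util}_n(f)}\;\ge\;\left(\frac58-\varepsilon\right)\beta ;$$ in particular $\mathcal{D}_{3,\beta}(f)\ge\left(\frac58-\varepsilon\right)\beta$.
   Context: Setting. $C$ is a set of $m$ candidates and $\beta\ge 1$ is a real parameter. Let $\mathcal{V}$ be a probability distribution on $[0,1]^C$ (utility vectors). For each $n$, the utility vectors $\mathbf{u}_1,\dots,\mathbf{u}_n$ of $n$ voters are drawn i.i.d. from $\mathcal{V}$, with $u_{i,j}\in[0,1]$ the utility of voter $i$ for candidate $j$. Given the utilities, each voter $i$ independently submits a random ranking $\pi_i$ of $C$ drawn from the Plackett–Luce model: positions are filled from top to bottom, and at each step a candidate $j$ is chosen among the not yet ranked candidates with probability proportional to $e^{\beta u_{i,j}}$. A voting rule $f$ maps each profile $\pi^n=(\pi_1,\dots,\pi_n)$ (for every $n$) to a probability distribution over $C$; it is deterministic if it always selects a single winner. Put $\mathrm{Util}_j=\mathbb{E}_{\mathbf{u}\sim\mathcal{V}}[u_j]$ and $\mathrm{Util}_n(f)=\mathbb{E}\big[\tfrac1n\sum_{i=1}^n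 u_{i,f(\pi^n)}\big]$, the expectation being over utilities, rankings and any internal randomness of $f$. The utilitarian distortion is $$\mathcal{D}_{m,\beta}(f)=\sup_{\mathcal{V}}\ \limsup_{n\to\infty}\ \frac{\max_{j\in C}\mathrm{Util}_j}{\mathrm{Util}_n(f)},$$ with the ratio taken to be $1$ if numerator and denominator are both $0$. Finite-precision tournament-based rule. Given a profile $\pi^n$, let $s_{j,j'}\in[0,1]$ be the fraction of voters ranking $j$ above $j'$. For a precision parameter $\rho>0$ define the coarsened edge weights $$W_\rho(j,j')=\left\lfloor\frac{s_{j,j'}-\frac12}{\rho}\right\rfloor\in\mathbb{Z}\qquad(j\ne j').$$ A voting rule is $\rho$-finite-precision tournament-based if its output depends on $\pi^n$ only through $W_\rho$. *)

(* Defs.v *)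
From HB Require Import structures.
From mathcomp Require Import all_boot all_order all_algebra all_fingroup.
From mathcomp Require Import all_classical all_reals all_analysis.

Set Implicit Arguments.
Unset Strict Implicit.
Unset Printing Implicit Defensive.

Import Order.TTheory GRing.Theory Num.Theory.
Import numFieldNormedType.Exports.

Local Open Scope classical_set_scope.
Local Open Scope ring_scope.

Set Warnings "-redundant-canonical-projection".

Section product_probability.
Context d1 d2 (T1 : measurableType d1) (T2 : measurableType d2) (R : realType).
Variables (P : probability T1 R) (Q : probability T2 R).

Definition prod_prob : set (T1 * T2) -> \bar R := (product_measure1 P Q).

HB.instance Definition _ := Measure.on prod_prob.

Let prod_prob_setT : prod_prob [set: _] = 1%:E.
Proof.
rewrite /prod_prob -setXTT.
transitivity (P setT * Q setT)%E; first exact: product_measure1E.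
by rewrite !probability_setT mule1.
Qed.

HB.instance Definition _ :=
  @Measure_isProbability.Build _ _ _ prod_prob prod_prob_setT.
End product_probability.

Section iid.
Context d (T : measurableType d) (R : realType).

Definition consp n (x : T * n.-tuple T) : n.+1.-tuple T :=
  [tuple of x.1 :: x.2].

Let measurable_consp n : measurable_fun [set: _] (@consp n).
Proof. exact: measurable_cons. Qed.

HB.instance Definition _ n := isMeasurableFun.Build _ _ _ _
  (@consp n) (@measurable_consp n).

(* The n-fold product measure: the law of n i.i.d. draws from P
   (see [iid_rect]). *)
Fixpoint iid (P : probability T R) (n : nat) : probability (n.-tuple T) R :=
  if n is k.+1 then distribution (prod_prob P (iid P k)) (@consp k)
  else dirac [tuple].

Lemma iid_rect (P : probability T R) n (A : 'I_n -> set T) :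
  (forall i, measurable (A i)) ->
  iid P n [set t | forall i, A i (tnth t i)] = (\prod_(i < n) P (A i))%E.
Proof.
elim: n A => [|n IH] A mA.
  rewrite big_ord0 [LHS]diracE mem_set//.
  by move=> [].
rewrite big_ord_recl -IH//= /distribution /pushforward/= /prod_prob.
rewrite -product_measure1E//.
  congr (_ _); apply/seteqP; split => -[x t] /=.
    by move=> h; split => [|i]; [have := h ord0 | have := h (lift ord0 i)];
      rewrite ?tnth0 ?tnthS.
  by move=> [h0 h] i; case: (unliftP ord0 i) => [j|] ->; rewrite ?tnth0 ?tnthS.
have -> : [set t : n.-tuple T | forall i, A (lift ord0 i) (tnth t i)] =
    \bigcap_(i in [set: 'I_n])
      ((fun t : n.-tuple T => tnth t i) @^-1` A (lift ord0 i)).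
  by apply/seteqP; split => t /= h i; [move=> _|]; apply: h.
apply: fin_bigcap_measurable => // i _.
by rewrite -[X in measurable X]setTI; apply: measurable_tnth.
Qed.
End iid.

Section voting.
Variable R : realType.

(* A ranking [r] lists the candidates from top to bottom: [r k] is the candidate
   in position [k], so [(r^-1)%g j] is the position of candidate [j]. *)
Definition ranking (m : nat) : finType := 'S_m.

Definition unit_cube (m : nat) : set (m.-tuple R) :=
  [set u | forall j, 0 <= tnth u j <= 1].
Arguments unit_cube : clear implicits.

Section plackett_luce.
Variables (m : nat) (beta : R) (u : m.-tuple R).

(* One factor per position; the candidates not yet ranked when position [k] is
   filled are those with final position at least [k]. *)
Definition plackett_luce (r : ranking m) : R :=
  \prod_(k < m) (expR (beta * tnth u (r k)) /
    \sum_(j < m | (k <= (r^-1)%g j)%N) expR (beta * tnth u j)).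
End plackett_luce.

Record voting_rule (m : nat) := VotingRule {
  winner_prob :> forall n, n.-tuple (ranking m) -> 'I_m -> R ;
  winner_prob_ge0 : forall n p j, 0 <= @winner_prob n p j ;
  winner_prob_sum1 : forall n p, \sum_(j < m) @winner_prob n p j = 1 }.

Definition deterministic m (f : voting_rule m) : Prop :=
  forall n (p : n.-tuple (ranking m)), (0 < n)%N ->
    exists j, f n p j = 1.

Definition pref_fraction m n (p : n.-tuple (ranking m)) (j j' : 'I_m) : R :=
  #|[pred i : 'I_n | ((tnth p i)^-1 j < (tnth p i)^-1 j')%g%N]|%:R / n%:R.

Definition coarse_weight (rho : R) m n (p : n.-tuple (ranking m))
    (j j' : 'I_m) : int :=
  Num.floor ((pref_fraction p j j' - 2^-1) / rho).

(* The weights do not record the number of voters, so profiles of different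
   sizes with the same weights have the same outcome. *)
Definition finite_precision_tournament (rho : R) m (f : voting_rule m) : Prop :=
  forall n n' (p : n.-tuple (ranking m)) (p' : n'.-tuple (ranking m)),
    (0 < n)%N -> (0 < n')%N ->
    (forall j j', j != j' ->
       coarse_weight rho p j j' = coarse_weight rho p' j j') ->
    forall j, f n p j = f n' p' j.

Section distortion.
Variables (m : nat) (beta : R).
Implicit Types (V : probability (m.-tuple R) R) (f : voting_rule m).

Definition util V (j : 'I_m) : R := \int[V]_u tnth u j.

(* The base value 0 of the maximum is harmless, as utilities are nonnegative. *)
Definition max_util V : R := \big[Num.max/0]_(j < m) util V j.

(* Given the utilities [us], the profile [p] has probability
   [\prod_i plackett_luce beta (tnth us i) (tnth p i)]. *)
Definition util_rule V f (n : nat) : R :=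
  \int[iid V n]_us \sum_(p : n.-tuple (ranking m))
    (\prod_(i < n) plackett_luce beta (tnth us i) (tnth p i)) *
    (n%:R^-1 * \sum_(i < n) \sum_(j < m) f n p j * tnth (tnth us i) j).

Definition ratio (a b : R) : \bar R :=
  if b == 0 then (if a == 0 then 1%:E else +oo%E) else (a / b)%:E.

Definition instance_distortion V f : \bar R :=
  limn_esup (fun n => ratio (max_util V) (util_rule V f n)).

Definition distortion f : \bar R :=
  ereal_sup [set instance_distortion V f |
    V in [set V : probability (m.-tuple R) R | V (unit_cube m) = 1%:E]].
End distortion.
End voting.
Arguments unit_cube R m : clear implicits.

(* Main.v *)
(* Let the profile be a cycle in which every candidate beats its successor by a
   margin in (0, rho). All such profiles have the same coarsened weights, so a
   deterministic rule elects the same candidate a on all of them. Let c = a + 1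
   be the candidate that a beats and b = a + 2 the one that beats a. It remains
   to find a distribution whose expected margins form such a cycle, with
   Util_b / Util_a > (5/8) beta; by Chebyshev's inequality the profile is then
   such a cycle with probability tending to 1.

   For small s, a mass 10s of voters has c above b above a with b close to c in
   utility, a mass 9s likes only b, and all others have utility 24s/beta for a
   and 0 for b and c. Near 0 the logistic function has slope 1/4, so this last
   group supports a with margin about 6s at a total utility cost of only
   24s/beta. The margins of (a,c), (c,b), (b,a) are then about 6s - 5s,
   5s - 4.5s and 9.5s - 6s, while Util_b = 18s, which gives a ratio of about
   (3/4) beta. Only the position of the margins relative to the cell (0, rho)
   matters, not their being equal, which is why 5/8 is exceeded. *)
From HB Require Import structures.
Require Import Defs.
From mathcomp Require Import all_boot all_order all_algebra all_fingroup.
From mathcomp Require Import all_classical all_reals all_analysis.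
From mathcomp Require Import measurable_realfun ring lra.
Set Implicit Arguments.
Unset Strict Implicit.
Unset Printing Implicit Defensive.
Import Order.TTheory GRing.Theory Num.Theory.
Local Open Scope classical_set_scope.
Local Open Scope ring_scope.

(** * Finitely supported distributions *)

Section finitely_supported.
Context d (T : measurableType d) (R : realType).
Variables (N : nat) (w : nat -> {nonneg R}) (v : nat -> T).
Hypothesis w1 : \sum_(k < N) (w k)%:num = 1.

Let atom k : measure T R := mscale (w k) \d_(v k).

Definition mixture : set T -> \bar R := msum atom N.

HB.instance Definition _ := Measure.on mixture.

Let mixture_setT : mixture [set: T] = 1%:E.
Proof.
transitivity (\sum_(k < N) (w k)%:num%:E)%E; last by rewrite sumEFin w1.
by apply: eq_bigr => k _; rewrite /atom /= /mscale /= diracT mule1.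
Qed.

HB.instance Definition _ :=
  @Measure_isProbability.Build _ _ _ mixture mixture_setT.

Definition mixture_prob : probability T R := mixture.

Lemma ge0_integral_mixture (F : T -> \bar R) : measurable_fun setT F ->
  (forall x, (0 <= F x)%E) ->
  (\int[mixture_prob]_x F x = \sum_(k < N) (w k)%:num%:E * F (v k))%E.
Proof.
move=> mF F0; rewrite ge0_integral_measure_sum//.
apply: eq_bigr => k _; rewrite ge0_integral_mscale// integral_dirac//.
by rewrite diracT mul1e.
Qed.

End finitely_supported.

(** * Expectations over independent draws from a finite set *)

Section expect.
Variable R : realType.

(** For a finitely supported distribution, types and rankings live on finite sets, and these sums
    replace the integrals. *)
Definition expect (Z : finType) (w : Z -> R) n (F : n.-tuple Z -> R) : R :=
  \sum_(t : n.-tuple Z) (\prod_(i < n) w (tnth t i)) * F t.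

Section one_space.
Variables (Z : finType) (w : Z -> R).

Lemma expect0 (F : 0.-tuple Z -> R) : expect w F = F [tuple].
Proof.
rewrite /expect (big_pred1 [tuple]) ?big_ord0 ?mul1r// => t.
by apply/esym/eqP; exact: tuple0.
Qed.

Lemma big_tuple_cons n (G : n.+1.-tuple Z -> R) :
  \sum_t G t = \sum_z \sum_(t : n.-tuple Z) G [tuple of z :: t].
Proof.
rewrite pair_big /=.
rewrite (reindex (fun zt : Z * n.-tuple Z => [tuple of zt.1 :: zt.2]))//.
exists (fun t => (thead t, [tuple of behead t])) => [[z t]|t] _ /=.
  by congr (_, _); apply/val_inj.
by rewrite [RHS]tuple_eta.
Qed.

Lemma expectS n (F : n.+1.-tuple Z -> R) :
  expect w F =
  \sum_z w z * expect w (fun t : n.-tuple Z => F [tuple of z :: t]).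
Proof.
rewrite /expect big_tuple_cons; apply: eq_bigr => z _.
rewrite mulr_sumr; apply: eq_bigr => t _.
rewrite big_ord_recl mulrA; congr (_ * _ * _).
by apply: eq_bigr => i _; rewrite tnthS.
Qed.

Lemma expectD n (F G : n.-tuple Z -> R) :
  expect w (fun t => F t + G t) = expect w F + expect w G.
Proof.
by rewrite /expect -big_split; apply: eq_bigr => t _; rewrite mulrDr.
Qed.

Lemma expectZ n c (F : n.-tuple Z -> R) :
  expect w (fun t => c * F t) = c * expect w F.
Proof. by rewrite /expect mulr_sumr; apply: eq_bigr => t _; rewrite mulrCA. Qed.

Lemma expect_sum n (I : finType) (F : I -> n.-tuple Z -> R) :
  expect w (fun t => \sum_i F i t) = \sum_i expect w (F i).
Proof.
by rewrite /expect exchange_big; apply: eq_bigr => t _; rewrite mulr_sumr.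
Qed.

Lemma eq_expect n (F G : n.-tuple Z -> R) : F =1 G -> expect w F = expect w G.
Proof. by move=> FG; apply: eq_bigr => t _; rewrite FG. Qed.

Hypothesis w0 : forall z, 0 <= w z.

Lemma ler_expect n (F G : n.-tuple Z -> R) :
  (forall t, F t <= G t) -> expect w F <= expect w G.
Proof.
move=> FG; apply: ler_sum => t _; apply: ler_wpM2l => //.
exact: prodr_ge0.
Qed.

Hypothesis w1 : \sum_z w z = 1.

Lemma expect_cst n c : expect w (fun _ : n.-tuple Z => c) = c.
Proof.
elim: n => [|n IH]; first by rewrite expect0.
by rewrite expectS; under eq_bigr do rewrite IH; rewrite -mulr_suml w1 mul1r.
Qed.

Lemma expect_sum_tnth n (g : Z -> R) :
  expect w (fun t : n.-tuple Z => \sum_(i < n) g (tnth t i)) =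
  n%:R * \sum_z w z * g z.
Proof.
elim: n => [|n IH]; first by rewrite expect0 big_ord0 mul0r.
have E z : expect w (fun t : n.-tuple Z =>
    \sum_(i < n.+1) g (tnth [tuple of z :: t] i)) =
    g z + n%:R * \sum_z w z * g z.
  rewrite -IH -[X in X + _](expect_cst n) -expectD; apply: eq_expect => t.
  by rewrite big_ord_recl; congr (_ + _); apply: eq_bigr => i _; rewrite tnthS.
rewrite expectS; under eq_bigr do rewrite E mulrDr.
by rewrite big_split -mulr_suml w1 mul1r /= -[in RHS]natr1 mulrDl mul1r addrC.
Qed.

Lemma expect_sqr_sum_tnth n (g : Z -> R) : \sum_z w z * g z = 0 ->
  expect w (fun t : n.-tuple Z => (\sum_(i < n) g (tnth t i)) ^+ 2) =
  n%:R * \sum_z w z * g z ^+ 2.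
Proof.
move=> g0; elim: n => [|n IH]; first by rewrite expect0 big_ord0 mul0r expr0n.
have E z : expect w (fun t : n.-tuple Z =>
    (\sum_(i < n.+1) g (tnth [tuple of z :: t] i)) ^+ 2) =
    g z ^+ 2 + n%:R * \sum_z w z * g z ^+ 2.
  (* The inserted term vanishes by [g0]; it is the expectation of the cross term of the square. *)
  have -> : g z ^+ 2 + n%:R * (\sum_z w z * g z ^+ 2) =
      (g z ^+ 2 + 2 * g z * (n%:R * \sum_z w z * g z))
      + n%:R * \sum_z w z * g z ^+ 2 by rewrite g0 !mulr0 addr0.
  rewrite -IH -expect_sum_tnth -expectZ.
  rewrite -[X in X + _ + _](expect_cst n) -!expectD.
  apply: eq_expect => t; rewrite big_ord_recl sqrrD !tnth0 -mulr_natl mulrA.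
  by under eq_bigr do rewrite tnthS.
rewrite expectS; under eq_bigr do rewrite E mulrDr.
by rewrite big_split -mulr_suml w1 mul1r /= -[in RHS]natr1 mulrDl mul1r addrC.
Qed.

End one_space.

(** Drawing all types and then the rankings given the types amounts to drawing [n] independent
    pairs, so averages over voters become averages of i.i.d. variables. *)
Lemma expect_prod (K Q : finType) (w : K -> R) (P : K -> Q -> R) n
    (H : n.-tuple K -> n.-tuple Q -> R) :
  expect w (fun k => \sum_(q : n.-tuple Q)
    (\prod_(i < n) P (tnth k i) (tnth q i)) * H k q) =
  expect (fun z => w z.1 * P z.1 z.2)
    (fun t : n.-tuple (K * Q) => H (map_tuple fst t) (map_tuple snd t)).
Proof.
rewrite /expect.
under eq_bigr do rewrite mulr_sumr.
rewrite pair_big /= (reindex (fun t : n.-tuple (K * Q) =>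
  (map_tuple fst t, map_tuple snd t))) /=.
  apply: eq_bigr => t _; rewrite mulrA -big_split; congr (_ * _).
  by apply: eq_bigr => i _; rewrite !tnth_map.
exists (fun kq => zip_tuple kq.1 kq.2) => [t|[k q]] _ /=.
  by apply/val_inj; rewrite /= zip_unzip.
have -> : map_tuple fst (zip_tuple k q) = k.
  by apply: val_inj; rewrite /= -/(unzip1 _) unzip1_zip ?size_tuple.
have -> // : map_tuple snd (zip_tuple k q) = q.
by apply: val_inj; rewrite /= -/(unzip2 _) unzip2_zip ?size_tuple.
Qed.

End expect.

(** * Integrals over i.i.d. draws from a finitely supported distribution *)

Section iid_mixture.
Context d (T : measurableType d) (R : realType).
Variables (N : nat) (w : nat -> {nonneg R}) (v : nat -> T).
Hypothesis w1 : \sum_(k < N) (w k)%:num = 1.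

Let V := mixture_prob v w1.
Let wN (k : 'I_N) : R := (w k)%:num.
Let vN n (t : n.-tuple 'I_N) : n.-tuple T := map_tuple (fun k : 'I_N => v k) t.

(** By induction on [n]: Tonelli's theorem, whence the sign condition, splits off the first draw. *)
Lemma ge0_integral_iid_mixture n (F : n.-tuple T -> R) :
  measurable_fun setT F ->
  (forall t, 0 <= F t) ->
  (\int[iid V n]_t (F t)%:E = (expect wN (fun t => F (vN t)))%:E)%E.
Proof.
elim: n F => [|n IH] F mF F0 /=.
  rewrite integral_dirac//; last exact/measurable_EFinP.
  by rewrite diracT mul1e expect0; congr (F _)%:E; apply/val_inj.
have mFc : measurable_fun setT (fun x : T * n.-tuple T => (F (consp x))%:E).
  by apply/measurable_EFinP; apply: measurableT_comp.
rewrite ge0_integral_distribution//; last exact/measurable_EFinP.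
rewrite [LHS](@fubini_tonelli1 _ _ _ _ _ V (iid V n)
  (fun x => (F (consp x))%:E))//.
rewrite ge0_integral_mixture; last 2 first.
- apply: (@measurable_fun_fubini_tonelli_F _ _ _ _ _ (iid V n)) => // x.
  by rewrite lee_fin.
- by move=> x; apply: integral_ge0 => t _; rewrite lee_fin.
rewrite expectS -sumEFin; apply: eq_bigr => k _.
rewrite EFinM; congr (_ * _)%E.
rewrite /fubini_F (IH (fun t => F (consp (v k, t)))) //.
  by congr EFin; apply: eq_bigr => t _; congr (_ * F _); apply/val_inj.
apply: (measurableT_comp mF).
by apply: measurable_cons => //; exact: measurable_id.
by move=> x; rewrite lee_fin; exact: F0.
Qed.

Lemma integral_iid_mixture n (F : n.-tuple T -> R) : measurable_fun setT F ->
  (\int[iid V n]_t F t)%R = expect wN (fun t => F (vN t)).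
Proof.
move=> mF; rewrite /Rintegral integralE -/(EFin \o F) funerpos funerneg.
have -> := ge0_integral_iid_mixture (measurable_funrpos mF) (funrpos_ge0 F).
have -> := ge0_integral_iid_mixture (measurable_funrneg mF) (funrneg_ge0 F).
rewrite -EFinB /= -mulN1r -expectZ -expectD; apply: eq_expect => t.
by rewrite mulN1r -[in RHS](funrposBneg F).
Qed.

Lemma integral_mixture (g : T -> R) : measurable_fun setT g ->
  (\int[V]_x g x)%R = \sum_(k < N) (w k)%:num * g (v k).
Proof.
move=> mg; rewrite /Rintegral integralE -/(EFin \o g) funerpos funerneg.
have ge0 (h : T -> R) : measurable_fun setT h -> (forall x, 0 <= h x) ->
    (\int[V]_x (h x)%:E = (\sum_(k < N) (w k)%:num * h (v k))%:E)%E.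
  move=> mh h0; rewrite ge0_integral_mixture; last 2 first.
  - exact/measurable_EFinP.
  - by move=> x; rewrite lee_fin; exact: h0.
  by rewrite -sumEFin; apply: eq_bigr => k _; rewrite EFinM.
have -> := ge0 _ (measurable_funrpos mg) (funrpos_ge0 g).
have -> := ge0 _ (measurable_funrneg mg) (funrneg_ge0 g).
rewrite -EFinB /= -sumrB; apply: eq_bigr => k _.
by rewrite -mulrBr -[in RHS](funrposBneg g).
Qed.

End iid_mixture.

(** * The Plackett-Luce model on three candidates *)

Section plackett_luce.
Variable R : realType.

Lemma plackett_luceE m (beta : R) (u : m.-tuple R) (r : ranking m) :
  plackett_luce beta u r =
  \prod_(k < m) (expR (beta * tnth u (r k)) /
    \sum_(l < m | (k <= l)%N) expR (beta * tnth u (r l))).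
Proof.
apply: eq_bigr => k _; congr (_ / _).
rewrite (reindex_inj (@perm_inj _ r)); apply: eq_bigl => l.
by rewrite permK.
Qed.

Lemma plackett_luce_ge0 m (beta : R) (u : m.-tuple R) (r : ranking m) :
  0 <= plackett_luce beta u r.
Proof.
apply: prodr_ge0 => k _; apply: divr_ge0; first exact: expR_ge0.
by apply: sumr_ge0 => j _; exact: expR_ge0.
Qed.

Lemma measurable_plackett_luce m (beta : R) (r : ranking m) :
  measurable_fun setT (fun u : m.-tuple R => plackett_luce beta u r).
Proof.
have mexp j :
    measurable_fun setT (fun u : m.-tuple R => expR (beta * tnth u j)).
  apply: measurableT_comp; first exact: measurable_expR.
  by apply: measurable_funM => //; exact: measurable_tnth.
under eq_fun do rewrite plackett_luceE.
apply: measurable_prod => k _.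
pose S (u : m.-tuple R) := \sum_(l < m | (k <= l)%N) expR (beta * tnth u (r l)).
have S0 u : 0 < S u.
  rewrite /S (bigD1 k) //= ltr_pwDl ?expR_gt0//.
  by apply: sumr_ge0 => j _; exact: expR_ge0.
have mS : measurable_fun setT S.
  rewrite /S; under eq_fun do rewrite big_mkcond.
  by apply: measurable_sum => l; case: (k <= l)%N.
(* Since [S] is positive, its inverse is exp(-ln S), which is measurable because [expR] and [ln]
   are. *)
have -> : (fun u : m.-tuple R => expR (beta * tnth u (r k)) / S u) =
    (fun u => expR (beta * tnth u (r k)) * expR (- ln (S u))).
  by apply/funext => u; rewrite expRN lnK// posrE.
apply: measurable_funM => //.
apply: measurableT_comp; first exact: measurable_expR.
apply: measurableT_comp; first exact: oppr_measurable.
by apply: measurableT_comp => //; exact: measurable_ln.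
Qed.

End plackett_luce.

Definition o0 : 'I_3 := Ordinal (isT : 0 < 3)%N.
Definition o1 : 'I_3 := Ordinal (isT : 1 < 3)%N.
Definition o2 : 'I_3 := Ordinal (isT : 2 < 3)%N.

Lemma ord3P (j : 'I_3) : [\/ j = o0, j = o1 | j = o2].
Proof.
by case: j => [[|[|[|//]]] ?];
  [apply: Or31|apply: Or32|apply: Or33]; apply: val_inj.
Qed.

Lemma big_ord3 (V : nmodType) (F : 'I_3 -> V) :
  \sum_i F i = F o0 + F o1 + F o2.
Proof.
rewrite !big_ord_recl big_ord0 addr0 addrA.
by congr (F _ + F _ + F _); apply: val_inj.
Qed.

(* Every permutation of Z/3 is of the form [i |-> x + i] or [i |-> x - i]. *)
Definition dihedral_fun (xb : 'I_3 * bool) (i : 'I_3) : 'I_3 :=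
  if xb.2 then xb.1 + i else xb.1 - i.

Lemma dihedral_inj xb : injective (dihedral_fun xb).
Proof.
by case: xb => x []; rewrite /dihedral_fun /= => i j /addrI //; move/oppr_inj.
Qed.

Definition dihedral xb : 'S_3 := perm (@dihedral_inj xb).

(** The values at [o0] and [o1] determine the shift and the sign, and both sides have 6 elements. *)
Lemma dihedral_bij : bijective dihedral.
Proof.
apply: inj_card_bij => [[x b] [y c] /permP E|]; last first.
  by rewrite card_prod card_ord card_bool card_Sn.
have := E o0; have := E o1; rewrite !permE /dihedral_fun.
by case: (ord3P x) => ->; case: (ord3P y) => ->; case: b c {E} => [] [].
Qed.

Lemma sum_S3 (V : nmodType) (F : 'I_3 -> 'I_3 -> 'I_3 -> V) :
  \sum_(r : 'S_3) F (r o0) (r o1) (r o2) =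
  F o0 o1 o2 + F o0 o2 o1 + (F o1 o2 o0 + F o1 o0 o2) +
  (F o2 o0 o1 + F o2 o1 o0).
Proof.
rewrite (reindex dihedral) /=; last exact: onW_bij dihedral_bij.
have E x b : F (dihedral (x, b) o0) (dihedral (x, b) o1) (dihedral (x, b) o2) =
    F (dihedral_fun (x, b) o0) (dihedral_fun (x, b) o1)
      (dihedral_fun (x, b) o2).
  by rewrite !permE.
transitivity (\sum_x \sum_b
    F (dihedral (x, b) o0) (dihedral (x, b) o1) (dihedral (x, b) o2)).
  by rewrite pair_big; apply: eq_bigr => -[].
under eq_bigr do rewrite big_bool !E.
rewrite big_ord3.
by do ![congr +%R]; congr F; apply: val_inj.
Qed.

(** This replaces the inverse of [r] by values of [r], the form that [sum_S3] handles. *)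
Lemma ranks_above3 (r : ranking 3) (j j' : 'I_3) : j != j' ->
  ((r^-1)%g j < (r^-1)%g j')%N = (r o0 == j) || (r o1 == j) && (r o0 != j').
Proof.
move=> jj'.
rewrite -(inj_eq (@perm_inj _ r^-1)) -[r o1 == j](inj_eq (@perm_inj _ r^-1)).
rewrite -[r o0 == j'](inj_eq (@perm_inj _ r^-1)) !permK.
have : (r^-1)%g j != (r^-1)%g j' by rewrite (inj_eq (@perm_inj _ _)).
by case: (ord3P ((r^-1)%g j)) => ->; case: (ord3P ((r^-1)%g j')) => ->.
Qed.

(** Pairwise marginals of Plackett-Luce are logistic (the Bradley-Terry model); for three candidates
    this is an explicit sum over six rankings. *)
Lemma sum_plackett_luce_above (R : realType) (beta : R) (u : 3.-tuple R)
    (j j' : 'I_3) : j != j' ->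
  \sum_(r : ranking 3)
    plackett_luce beta u r * ((r^-1)%g j < (r^-1)%g j')%N%:R =
  expR (beta * tnth u j) / (expR (beta * tnth u j) + expR (beta * tnth u j')).
Proof.
move=> jj'; pose e i := expR (beta * tnth u i).
have e0 i : 0 < e i by exact: expR_gt0.
rewrite -!/(e _).
under eq_bigr => r _.
  rewrite plackett_luceE ranks_above3//.
  rewrite (_ : \prod_(k < 3) _ = e (r o0) / (e (r o0) + e (r o1) + e (r o2)) *
    (e (r o1) / (e (r o1) + e (r o2)))); last first.
    have D k : \sum_(l < 3 | (k <= l)%N) expR (beta * tnth u (r l)) =
        (if (k <= 0)%N then e (r o0) else 0) +
        (if (k <= 1)%N then e (r o1) else 0) +
        (if (k <= 2)%N then e (r o2) else 0) by rewrite big_mkcond big_ord3.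
    under eq_bigr do rewrite D.
    rewrite !big_ord_recl big_ord0 mulr1 /= !add0r.
    rewrite (_ : lift ord0 (lift ord0 ord0) = o2); last exact: val_inj.
    rewrite (_ : lift ord0 ord0 = o1); last exact: val_inj.
    rewrite (_ : ord0 = o0); last exact: val_inj.
    by rewrite -!/(e _) (divff (lt0r_neq0 (e0 (r o2)))) mulr1.
  over.
rewrite (sum_S3 (fun x y z => e x / (e x + e y + e z) * (e y / (e y + e z)) *
  ((x == j) || (y == j) && (x != j'))%:R)).
have := e0 o0; have := e0 o1; have := e0 o2.
move: jj'; case: (ord3P j) => ->; case: (ord3P j') => -> //= _;
  rewrite !mulr1 ?mulr0 ?add0r ?addr0;
  move: (e o0) (e o1) (e o2) => x y z z0 y0 x0; field;
  by rewrite !gt_eqF ?addr_gt0.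
Qed.

Lemma mixture_prob_full d (T : measurableType d) (R : realType) (N : nat)
    (w : nat -> {nonneg R}) (v : nat -> T) (w1 : \sum_(k < N) (w k)%:num = 1)
    (A : set T) : (forall k, A (v k)) -> mixture_prob v w1 A = 1%:E.
Proof.
move=> Av; transitivity (\sum_(k < N) (w k)%:num%:E)%E; last first.
  by rewrite sumEFin w1.
apply: eq_bigr => k _; rewrite /= /mscale /= /dirac.
by rewrite indicE mem_set// mule1.
Qed.

(** * Mean and second moment of an average *)

Section mean_deviation.
Variables (R : realType) (Z : finType) (w : Z -> R).
Hypothesis w0 : forall z, 0 <= w z.
Hypothesis w1 : \sum_z w z = 1.

Lemma expect_avg n (g : Z -> R) : (0 < n)%N ->
  expect w (fun t : n.-tuple Z => n%:R^-1 * \sum_(i < n) g (tnth t i)) =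
  \sum_z w z * g z.
Proof.
move=> n0; rewrite expectZ expect_sum_tnth// mulKf// pnatr_eq0.
by rewrite -lt0n.
Qed.

(** The variance bound behind Chebyshev's inequality: [n] variances of at most 1, divided by the
    square of [n]. *)
Lemma expect_sqr_avg_le n (g : Z -> R) : (0 < n)%N ->
  \sum_z w z * g z = 0 -> (forall z, g z ^+ 2 <= 1) ->
  expect w (fun t : n.-tuple Z =>
    (n%:R^-1 * \sum_(i < n) g (tnth t i)) ^+ 2) <= n%:R^-1.
Proof.
move=> n0 g0 g1; have n0R : 0 < n%:R :> R by rewrite ltr0n.
have -> : expect w (fun t : n.-tuple Z =>
    (n%:R^-1 * \sum_(i < n) g (tnth t i)) ^+ 2) =
    n%:R^-1 ^+ 2 * (n%:R * \sum_z w z * g z ^+ 2).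
  rewrite -expect_sqr_sum_tnth// -expectZ; apply: eq_expect => t.
  by rewrite exprMn.
rewrite expr2 mulrA mulfVK ?gt_eqF// -[leRHS]mulr1 ler_pM2l ?invr_gt0//.
rewrite -w1; apply: ler_sum => z _; rewrite -[leRHS]mulr1.
by apply: ler_wpM2l.
Qed.

End mean_deviation.

Lemma limn_esup_ge (R : realType) (u : (\bar R)^nat) (l : \bar R) :
  (\forall n \near \oo, (l <= u n)%E) -> (l <= limn_esup u)%E.
Proof.
move=> lu; apply: le_ereal_inf_tmp => _ [V Voo <-].
have [n [ln Vn]] := filter_ex (filterI lu Voo).
by apply: (le_trans ln); apply: ereal_sup_ubound; exists n.
Qed.

(** * Profiles that form a cycle with margins in one cell *)

Definition cyclic_profile (R : realType) (rho : R) n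
    (p : n.-tuple (ranking 3)) :=
  forall i : 'I_3, coarse_weight rho p i (i + 1) = 0 /\
                   coarse_weight rho p (i + 1) i = -1.

Section profiles.
Variable R : realType.

Lemma pref_fraction_avg m n (p : n.-tuple (ranking m)) (j j' : 'I_m) :
  pref_fraction R p j j' =
  n%:R^-1 * \sum_(i < n) (((tnth p i)^-1)%g j < ((tnth p i)^-1)%g j')%N%:R.
Proof.
rewrite /pref_fraction mulrC; congr (_ * _).
rewrite -sum1_card natr_sum big_mkcond; apply: eq_bigr => i _.
by rewrite inE; case: ltnP.
Qed.

Lemma pref_fractionC m n (p : n.-tuple (ranking m)) (j j' : 'I_m) :
  (0 < n)%N -> j != j' ->
  pref_fraction R p j' j = 1 - pref_fraction R p j j'.
Proof.
move=> n0 jj'; apply/eqP; rewrite eq_sym subr_eq eq_sym.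
rewrite !pref_fraction_avg -mulrDr -big_split /=.
rewrite (eq_bigr (fun=> 1)) => [|i _].
  by rewrite sumr_const card_ord -mulr_natl mulr1 mulVf// pnatr_eq0 -lt0n.
have : (tnth p i)^-1%g j != (tnth p i)^-1%g j'.
  by rewrite (inj_eq (@perm_inj _ _)).
by rewrite -(inj_eq val_inj) /=; case: ltngtP; rewrite ?addr0 ?add0r.
Qed.

Lemma ord3_succ_neq (i : 'I_3) : i != i + 1.
Proof. by case: (ord3P i) => ->. Qed.

Lemma cyclic_profileP (rho : R) n (p : n.-tuple (ranking 3)) :
  0 < rho -> (0 < n)%N ->
  (forall i : 'I_3, 2^-1 < pref_fraction R p i (i + 1) < 2^-1 + rho) ->
  cyclic_profile rho p.
Proof.
move=> rho0 n0 H i; have /andP[s1 s2] := H i.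
rewrite /coarse_weight (pref_fractionC p n0 (ord3_succ_neq i)).
(* A margin in (0, rho) has floor 0 after scaling, and the opposite margin has floor -1. *)
split; apply/eqP; rewrite floor_eq ler_pdivlMr// ltr_pdivrMr//; apply/andP;
  by split; lra.
Qed.

(** Cyclic profiles of all sizes share their weights, so the winner of one of them wins all. *)
Lemma cyclic_winner (rho : R) (f : voting_rule R 3) :
  deterministic f -> finite_precision_tournament rho f ->
  exists a : 'I_3, forall n (p : n.-tuple (ranking 3)),
    (0 < n)%N -> cyclic_profile rho p -> f n p a = 1.
Proof.
move=> fdet ffin.
have [[n [p [n0 cp]]]|none] := pselect (exists n,
  exists p : n.-tuple (ranking 3),
  (0 < n)%N /\ cyclic_profile rho p).
  have [a fa] := fdet n p n0; exists a => n' p' n0' cp'.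
  rewrite -fa; apply: ffin => // j j' jj'.
  have [->|->] : j' = j + 1 \/ j = j' + 1.
    by move: jj'; case: (ord3P j) => ->; case: (ord3P j') => ->; move=> // _;
      try (by left; apply: val_inj); right; apply: val_inj.
  - by rewrite (cp j).1 (cp' j).1.
  - by rewrite (cp j').2 (cp' j').2.
(* Without any cyclic profile the claim is vacuous and any candidate serves. *)
by exists ord0 => n p n0 cp; case: none; exists n, p.
Qed.

End profiles.

(** * The expected welfare of the winner of a cycle *)

Section election.
Variables (R : realType) (beta rho : R) (N : nat) (w : nat -> {nonneg R}).
Variables (x : nat -> 'I_3 -> R) (f : voting_rule R 3) (a : 'I_3).
Hypothesis w1 : \sum_(k < N) (w k)%:num = 1.
Hypothesis x01 : forall k j, 0 <= x k j <= 1.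
Hypothesis rho0 : 0 < rho.
Hypothesis fa : forall n (p : n.-tuple (ranking 3)),
  (0 < n)%N -> cyclic_profile rho p -> f n p a = 1.

(* [x k d] is the utility of candidate [a + d] for voters of type [k]. *)
Definition shifted_utility k : 3.-tuple R := [tuple x k (j - a) | j < 3].

Definition shifted_instance := mixture_prob shifted_utility w1.

(** The expected fraction of voters who rank [a + d] above [a + d + 1], as [law_beats] shows. *)
Definition win_prob (d : 'I_3) : R := \sum_(k < N) (w k)%:num *
  (expR (beta * x k d) / (expR (beta * x k d) + expR (beta * x k (d + 1)))).

Hypothesis win_prob_bounds : forall d, 2^-1 < win_prob d < 2^-1 + rho.

Lemma util_shifted_instance j :
  util shifted_instance j = \sum_(k < N) (w k)%:num * x k (j - a).
Proof.
rewrite /util integral_mixture; last exact: measurable_tnth.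
by apply: eq_bigr => k _; rewrite tnth_mktuple.
Qed.

Lemma shifted_instance_cube : shifted_instance (unit_cube R 3) = 1%:E.
Proof. by apply: mixture_prob_full => k j; rewrite tnth_mktuple. Qed.

Let law (z : 'I_N * ranking 3) : R :=
  (w z.1)%:num * plackett_luce beta (shifted_utility z.1) z.2.

Let law_ge0 z : 0 <= law z.
Proof. by rewrite mulr_ge0// plackett_luce_ge0. Qed.

Let lawE (h : 'I_N -> ranking 3 -> R) : \sum_z law z * h z.1 z.2 =
  \sum_(k < N) (w k)%:num *
    \sum_(r : ranking 3) plackett_luce beta (shifted_utility k) r * h k r.
Proof.
transitivity (\sum_(k < N) \sum_(r : ranking 3) law (k, r) * h k r).
  by rewrite pair_big; apply: eq_bigr => -[].
apply: eq_bigr => k _; rewrite mulr_sumr.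
by apply: eq_bigr => r _; rewrite mulrA.
Qed.

Let beats (d : 'I_3) (r : ranking 3) : R :=
  ((r^-1)%g (a + d)%R < (r^-1)%g (a + d + 1)%R)%N%:R.

Let law_beats d : \sum_z law z * beats d z.2 = win_prob d.
Proof.
rewrite (lawE (fun _ => beats d)); apply: eq_bigr => k _; congr (_ * _).
rewrite sum_plackett_luce_above ?ord3_succ_neq// !tnth_mktuple.
have aK i : a + i - a = i by rewrite addrC addKr.
by rewrite aK -[a + d + 1]addrA aK.
Qed.

(** Either [o0] is above [o1] or the reverse, and the two logistic probabilities add up to 1. *)
Let sum_plackett_luce (u : 3.-tuple R) :
  \sum_(r : ranking 3) plackett_luce beta u r = 1.
Proof.
have jj : o0 != o1 by [].
have jj' : o1 != o0 by [].
transitivity (\sum_(r : ranking 3)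
    (plackett_luce beta u r * ((r^-1)%g o0 < (r^-1)%g o1)%N%:R +
     plackett_luce beta u r * ((r^-1)%g o1 < (r^-1)%g o0)%N%:R)).
  apply: eq_bigr => r _; rewrite -mulrDr.
  have : (r^-1)%g o0 != (r^-1)%g o1 by rewrite (inj_eq (@perm_inj _ _)).
  rewrite -(inj_eq val_inj) /=.
  by case: ltngtP => // _ _; rewrite ?addr0 ?add0r mulr1.
rewrite big_split /= !sum_plackett_luce_above//.
rewrite [X in _ + _ / X]addrC -mulrDl divff// gt_eqF// addr_gt0// expR_gt0//.
Qed.

Let law1 : \sum_z law z = 1.
Proof.
under eq_bigr do rewrite -[law _]mulr1.
rewrite (lawE (fun _ _ => 1)) -[RHS]w1; apply: eq_bigr => k _.
by under eq_bigr do rewrite mulr1; rewrite sum_plackett_luce mulr1.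
Qed.

Let welfare n (t : n.-tuple ('I_N * ranking 3)) : R :=
  n%:R^-1 * \sum_(i < n) \sum_(j < 3)
    f n (map_tuple snd t) j * x (tnth t i).1 (j - a).

Let util_ruleE n :
  util_rule beta shifted_instance f n = expect law (@welfare n).
Proof.
rewrite /util_rule integral_iid_mixture; last first.
  apply: measurable_sum => p; apply: measurable_funM.
    apply: measurable_prod => i _.
    apply: (measurableT_comp (measurable_plackett_luce beta (tnth p i))).
    exact: measurable_tnth.
  apply: measurable_funM => //; apply: measurable_sum => i.
  apply: measurable_sum => j; apply: measurable_funM => //.
  by apply: (measurableT_comp (measurable_tnth j)); exact: measurable_tnth.
transitivity (expect (fun k : 'I_N => (w k)%:num)
  (fun k : n.-tuple 'I_N => \sum_(q : n.-tuple (ranking 3))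
    (\prod_(i < n) plackett_luce beta (shifted_utility (tnth k i)) (tnth q i)) *
    (n%:R^-1 * \sum_(i < n) \sum_(j < 3) f n q j * x (tnth k i) (j - a)))).
  apply: eq_expect => t; apply: eq_bigr => p _; congr (_ * (_ * _)).
    by apply: eq_bigr => i _; rewrite tnth_map.
  apply: eq_bigr => i _; apply: eq_bigr => j _.
  by rewrite tnth_map tnth_mktuple.
rewrite (expect_prod _
  (fun (k : 'I_N) r => plackett_luce beta (shifted_utility k) r)).
apply: eq_expect => t; rewrite /welfare; congr (_ * _).
by apply: eq_bigr => i _; apply: eq_bigr => j _; rewrite tnth_map.
Qed.

Let welfare_ge0 n (t : n.-tuple ('I_N * ranking 3)) : 0 <= welfare t.
Proof.
rewrite mulr_ge0 ?invr_ge0//; apply: sumr_ge0 => i _; apply: sumr_ge0 => j _.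
by rewrite mulr_ge0 ?winner_prob_ge0//;
  have /andP[] := x01 (tnth t i).1 (j - a).
Qed.

Let avg_le1 n (g : 'I_n -> R) : (0 < n)%N -> (forall i, g i <= 1) ->
  n%:R^-1 * \sum_(i < n) g i <= 1.
Proof.
move=> n0 g1; rewrite ler_pdivrMl ?ltr0n// mulr1.
apply: le_trans (ler_sum _ (fun i _ => g1 i)) _.
by rewrite sumr_const card_ord.
Qed.

Let welfare_le1 n (t : n.-tuple ('I_N * ranking 3)) :
  (0 < n)%N -> welfare t <= 1.
Proof.
move=> n0; apply: avg_le1 => // i.
rewrite -(winner_prob_sum1 f (map_tuple snd t)).
apply: ler_sum => j _; rewrite -[leRHS]mulr1; apply: ler_wpM2l.
  exact: winner_prob_ge0.
by have /andP[] := x01 (tnth t i).1 (j - a).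
Qed.

Let dev d (z : 'I_N * ranking 3) : R := beats d z.2 - win_prob d.

Let dev0 d : \sum_z law z * dev d z = 0.
Proof.
under eq_bigr do rewrite mulrBr.
by rewrite sumrB law_beats -mulr_suml law1 mul1r subrr.
Qed.

Let win_prob01 d : 0 <= win_prob d <= 1.
Proof.
rewrite -law_beats; apply/andP; split.
  by apply: sumr_ge0 => z _; rewrite mulr_ge0// /beats.
rewrite -law1; apply: ler_sum => z _; rewrite -[leRHS]mulr1.
by apply: ler_wpM2l => //; rewrite /beats; case: ltnP.
Qed.

Let dev_sqr_le1 d z : dev d z ^+ 2 <= 1.
Proof.
by have /andP[] := win_prob01 d; rewrite /dev /beats; case: ltnP => _ /=; nra.
Qed.

(** Deviations smaller than this keep the observed fraction between 1/2 and 1/2 + rho. *)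
Let slack d : R := Num.min (win_prob d - 2^-1) (2^-1 + rho - win_prob d).

Let slack_gt0 d : 0 < slack d.
Proof.
by have /andP[? ?] := win_prob_bounds d; rewrite /slack lt_min;
  apply/andP; split; lra.
Qed.

Let avg n (g : 'I_N * ranking 3 -> R) (t : n.-tuple ('I_N * ranking 3)) : R :=
  n%:R^-1 * \sum_(i < n) g (tnth t i).

(** Chebyshev's argument made pointwise. If all deviations are below [slack], then [a] wins and the
    first term is the welfare; otherwise some summand is at least 1, which bounds any welfare. *)
Let welfare_le n (t : n.-tuple ('I_N * ranking 3)) : (0 < n)%N ->
  welfare t <= avg (fun z => x z.1 0) t +
    \sum_d slack d ^- 2 * avg (dev d) t ^+ 2.
Proof.
move=> n0.
have sq0 d : 0 <= slack d ^- 2 * avg (dev d) t ^+ 2.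
  by rewrite mulr_ge0 ?sqr_ge0// invr_ge0 sqr_ge0.
have x0 : 0 <= avg (fun z => x z.1 0) t.
  rewrite mulr_ge0 ?invr_ge0//; apply: sumr_ge0 => i _.
  by have /andP[] := x01 (tnth t i).1 0.
have [/forallP near|/forallPn[d]] :=
    boolP [forall d : 'I_3, `|avg (dev d) t| < slack d]; last first.
  rewrite -leNgt => far; apply: le_trans (welfare_le1 _ n0) _.
  rewrite (bigD1 d)//= addrCA -[leLHS]addr0; apply: lerD; last first.
    by rewrite addr_ge0//; apply: sumr_ge0.
  rewrite mulrC ler_pdivlMr ?exprn_gt0// mul1r -[leRHS]real_normK ?num_real//.
  by rewrite lerXn2r ?nnegrE// ltW.
suff fa1 : f n (map_tuple snd t) a = 1.
  rewrite -[leLHS]addr0; apply: lerD; last by apply: sumr_ge0.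
  rewrite /welfare /avg; apply: ler_wpM2l; first by rewrite invr_ge0.
  apply: ler_sum => i _.
  rewrite (bigD1 a)//= fa1 mul1r subrr big1 ?addr0// => j ja.
  suff -> : f n (map_tuple snd t) j = 0 by rewrite mul0r.
  have := winner_prob_sum1 f (map_tuple snd t).
  rewrite (bigD1 a)//= (bigD1 j)//= fa1 => /eqP.
  rewrite -subr_eq0 addrAC subrr add0r paddr_eq0 ?winner_prob_ge0//; last first.
    by apply: sumr_ge0 => i' _; exact: winner_prob_ge0.
  by case/andP => /eqP.
apply: fa => //; apply: cyclic_profileP => // i.
(* Candidate [i] has offset [i - a]; the observed fraction is its mean plus the average
   deviation. *)
have -> : pref_fraction R (map_tuple snd t) i (i + 1) =
    win_prob (i - a) + avg (dev (i - a)) t.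
  rewrite pref_fraction_avg /avg /dev sumrB sumr_const card_ord mulrBr.
  rewrite -[win_prob _ *+ _]mulr_natl mulKf ?pnatr_eq0 -?lt0n//.
  rewrite addrCA subrr addr0.
  congr (_ * _); apply: eq_bigr => k _; rewrite tnth_map /beats.
  by rewrite (addrC a) subrK.
have := near (i - a); rewrite /slack lt_min !ltr_norml.
by move=> /andP[/andP[? ?] /andP[? ?]]; apply/andP; split; lra.
Qed.

Lemma util_rule_shifted_instance n : (0 < n)%N ->
  0 <= util_rule beta shifted_instance f n <=
  \sum_(k < N) (w k)%:num * x k 0 + n%:R^-1 * \sum_d slack d ^- 2.
Proof.
move=> n0; rewrite util_ruleE; apply/andP; split.
  by apply: sumr_ge0 => t _; rewrite mulr_ge0//; exact: prodr_ge0.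
apply: (le_trans (ler_expect law_ge0 (fun t => welfare_le t n0))).
rewrite expectD; apply: lerD.
  rewrite expect_avg// (lawE (fun k _ => x k 0)); apply: ler_sum => k _.
  by rewrite -mulr_suml sum_plackett_luce mul1r.
rewrite expect_sum mulr_sumr; apply: ler_sum => d _; rewrite expectZ mulrC.
apply: ler_wpM2r; first by rewrite invr_ge0 sqr_ge0.
exact: expect_sqr_avg_le.
Qed.

Lemma util_rule_shifted_instance_near (e : R) : 0 < e -> \forall n \near \oo,
  0 <= util_rule beta shifted_instance f n <=
  \sum_(k < N) (w k)%:num * x k 0 + e.
Proof.
move=> e0; pose c := \sum_d slack d ^- 2.
near=> n.
have n0 : (0 < n)%N by near: n; exact: nbhs_infty_gt.
have /andP[-> /le_trans] /= := util_rule_shifted_instance n0; apply.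
rewrite lerD2l ler_pdivrMl ?ltr0n// mulrC -ler_pdivrMl//.
by near: n; exact: nbhs_infty_ger.
Unshelve. all: by end_near.
Qed.

End election.

(** * The instance *)

Section logistic.
Variable R : realType.
Implicit Types y z s : R.

Lemma softmax2E y z : expR y / (expR y + expR z) = (1 + expR (z - y))^-1.
Proof.
have := expR_gt0 y; have := expR_gt0 z; rewrite expRD expRN => z0 y0.
by field; rewrite !gt_eqF// addr_gt0.
Qed.

Lemma softmax2_bounds y z : 0 <= expR y / (expR y + expR z) <= 1.
Proof.
have y0 := expR_gt0 y; have z0 := expR_gt0 z.
have yz0 : 0 < expR y + expR z by rewrite addr_gt0.
apply/andP; split; first by rewrite divr_ge0 ?ltW.
by rewrite ler_pdivrMr// mul1r lerDl ltW.
Qed.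

(** From 1 + x <= exp x follows exp 40 >= 41, and 41/42 exceeds 24/25. *)
Lemma softmax2_large y z : 40 <= y - z -> 24 / 25 <= expR y / (expR y + expR z).
Proof.
move=> yz; rewrite softmax2E; have E0 := expR_gt0 (z - y).
rewrite -[leRHS]mul1r ler_pdivlMr; last by rewrite addr_gt0.
have := expR_ge1Dx (y - z); have := expRxMexpNx_1 (y - z).
by rewrite opprB => ? ?; nra.
Qed.

(** The slope 1/4 of the logistic function at 0 turns 24s into 6s; the bound on [s] keeps the error
    within 2s/5. *)
Lemma softmax2_small s : 0 < s -> s <= 1 / 1000 ->
  1 / 2 + 28 / 5 * s <= expR (24 * s) / (expR (24 * s) + expR 0) <=
    1 / 2 + 32 / 5 * s.
Proof.
move=> s0 s1; rewrite softmax2E sub0r.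
have := expR_ge1Dx (24 * s); have := expR_ge1Dx (- (24 * s)).
have := expRxMexpNx_1 (24 * s); have := expR_gt0 (- (24 * s)).
move: (expR (24 * s)) (expR (- (24 * s))) => E F F0 EF F1 E1.
apply/andP; split.
  by rewrite -[leRHS]mul1r ler_pdivlMr; [nra|lra].
by rewrite -[leLHS]mul1r ler_pdivrMr; [nra|lra].
Qed.

End logistic.

(** * The three types of voters *)

Section bad_instance.
Variable R : realType.
Variables beta rho s : R.
Hypotheses (beta400 : 400 <= beta) (s0 : 0 < s) (s1 : s <= 1 / 1000).
Hypothesis srho : 20 * s <= rho.

Let mass0 : 0 <= 10 * s.
Proof. by rewrite mulr_ge0// ltW. Qed.
Let mass1 : 0 <= 9 * s.
Proof. by rewrite mulr_ge0// ltW. Qed.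
Let mass2 : 0 <= 1 - 19 * s.
Proof. by move: s0 s1; lra. Qed.

Definition type_mass (k : nat) : {nonneg R} :=
  nth (NngNum mass2) [:: NngNum mass0; NngNum mass1] k.

(** Entries are ordered by offset from [a], that is a, c, b. As for the masses, the third type is
    the default of [nth]. *)
Definition type_utility (k : nat) (d : 'I_3) : R :=
  nth 0 (nth [:: 24 * s / beta; 0; 0] [:: [:: 0; 1; 9 / 10]; [:: 0; 0; 1]] k) d.

Lemma sum_type_mass (F : nat -> R) : \sum_(k < 3) (type_mass k)%:num * F k =
  10 * s * F 0%N + 9 * s * F 1%N + (1 - 19 * s) * F 2%N.
Proof. by rewrite big_ord3. Qed.

Lemma type_mass1 : \sum_(k < 3) (type_mass k)%:num = 1.
Proof.
under eq_bigr do rewrite -[_%:num]mulr1.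
by rewrite (sum_type_mass (fun=> 1)); ring.
Qed.

Let beta_gt0 : 0 < beta.
Proof. by move: beta400; lra. Qed.

Let betaK : beta * (24 * s / beta) = 24 * s.
Proof. by rewrite mulrC divfK// gt_eqF. Qed.

Lemma type_utility01 k d : 0 <= type_utility k d <= 1.
Proof.
have u0 : 0 <= 24 * s / beta by rewrite divr_ge0 ?mulr_ge0// ltW.
have u1 : 24 * s / beta <= 1.
  by rewrite ler_pdivrMr//; move: s0 s1 beta400; lra.
by case: k => [|[|k]]; case: (ord3P d) => ->;
  rewrite /type_utility /= ?nth_nil /=; apply/andP; split; lra.
Qed.

(** All margins are at most 57s/5, hence below [rho]; the three cases differ in why they are
    positive. *)
Lemma type_win_prob_bounds d :
  2^-1 < win_prob beta 3 type_mass type_utility d < 2^-1 + rho.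
Proof.
rewrite /win_prob (sum_type_mass (fun k => expR (beta * type_utility k d) /
  (expR (beta * type_utility k d) + expR (beta * type_utility k (d + 1))))).
pose P (y z : R) := expR y / (expR y + expR z).
rewrite -!/(P _ _).
have P0 y z : 0 <= P y z by have /andP[] := softmax2_bounds y z.
have P1 y z : P y z <= 1 by have /andP[] := softmax2_bounds y z.
have PC y z : P y z = 1 - P z y.
  rewrite /P [expR z + _]addrC.
  have := expR_gt0 y; have := expR_gt0 z => *.
  by field; rewrite gt_eqF// addr_gt0.
have PE y : P y y = 1 / 2 by have := PC y y; lra.
have large y z : 40 <= y - z -> 24 / 25 <= P y z by exact: softmax2_large.
have /andP[] := softmax2_small s0 s1; rewrite -/(P _ _) => h1 h2.
clearbody P.
have sM (p : R) : 0 <= p -> p <= 1 -> 0 <= s * p <= s.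
  move=> p0 p1; apply/andP; split; first by rewrite mulr_ge0// ltW.
  by rewrite ler_piMr// ltW.
have sM' (p : R) : 24 / 25 <= p -> 24 / 25 * s <= s * p.
  by move=> p1; rewrite mulrC ler_pM2l.
(* The lower bound has to exceed the 5s that type 0 can take from the margin of a over c. *)
have [T1 T2] : 51 / 10 * s <= (1 - 19 * s) * (P (24 * s) 0 - 1 / 2) /\
    (1 - 19 * s) * (P (24 * s) 0 - 1 / 2) <= 32 / 5 * s.
  move: h1 h2 (s0) (s1); move: (P _ _) => p h1 h2 s0' s1'.
  (* These products bound the quadratic term s(p - 1/2), so that linear arithmetic suffices. *)
  have : 0 <= (1 / 1000 - s) * (p - 1 / 2) by rewrite mulr_ge0; lra.
  have : 0 <= s * (p - 1 / 2) by rewrite mulr_ge0; lra.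
  by move=> ? ?; split; lra.
have o0S : o0 + 1 = o1 by apply: val_inj.
have o1S : o1 + 1 = o2 by apply: val_inj.
have o2S : o2 + 1 = o0 by apply: val_inj.
move: (s0) (s1) (srho) (beta400) => ? ? ? ?.
case: (ord3P d) => ->;
  rewrite ?o0S ?o1S ?o2S /type_utility /= ?PE ?betaK ?mulr0 ?mulr1.
(* a against c: at least 51s/10 from type 2, at most 5s lost to type 0. *)
- have /andP[] := sM _ (P0 0 beta) (P1 0 beta) => *.
  by apply/andP; split; lra.
(* c against b: at least 23s/5 from type 0, at most 9s/2 lost to type 1. *)
- have /andP[] := sM _ (P0 0 beta) (P1 0 beta) => *.
  have /andP[] := sM _ (P0 beta (beta * (9 / 10)))
    (P1 beta (beta * (9 / 10))) => *.
  have := sM' _ (large beta (beta * (9 / 10)) _) => /(_ ltac:(lra)) *.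
  by apply/andP; split; lra.
(* b against a: at least 19s * 23/50 from types 0 and 1, at most 32s/5 lost to type 2. *)
- rewrite (PC 0).
  have /andP[] := sM _ (P0 beta 0) (P1 beta 0) => *.
  have /andP[] := sM _ (P0 (beta * (9 / 10)) 0) (P1 (beta * (9 / 10)) 0) => *.
  have := sM' _ (large beta 0 _) => /(_ ltac:(lra)) *.
  have := sM' _ (large (beta * (9 / 10)) 0 _) => /(_ ltac:(lra)) *.
  by apply/andP; split; lra.
Qed.

End bad_instance.

(** * The lower bound on the distortion *)

Theorem theorem8p2 (R : realType) (rho : R) (rho_gt0 : 0 < rho) :
  forall eps : R, 0 < eps ->
  exists2 beta0 : R, 0 < beta0 &
  forall beta : R, 1 <= beta -> beta0 <= beta ->
  forall f : voting_rule R 3,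
    deterministic f -> finite_precision_tournament rho f ->
    (exists2 V : probability (3.-tuple R) R,
       V (unit_cube R 3) = 1%:E &
       (((5%:R / 8%:R - eps) * beta)%:E <= instance_distortion beta V f)%E) /\
    (((5%:R / 8%:R - eps) * beta)%:E <= distortion beta f)%E.
Proof.
(* From 400 on, the utilities 1 and 9/10 differ by at least 40 once multiplied by [beta], as
   [softmax2_large] requires. *)
move=> eps eps0; exists 400 => [|beta _ beta400 f fdet ffin]; first by lra.
suff [V Vcube Vdist] : exists2 V : probability (3.-tuple R) R,
    V (unit_cube R 3) = 1%:E &
    (((5%:R / 8%:R - eps) * beta)%:E <= instance_distortion beta V f)%E.
  split; first by exists V.
  by apply: le_trans Vdist _; apply: ereal_sup_ubound; exists V.
have [a fa] := cyclic_winner fdet ffin.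
have [s [s0 s1 srho]] : exists s : R, [/\ 0 < s, s <= 1 / 1000 & 20 * s <= rho].
  exists (Num.min (rho / 20) (1 / 1000)); split.
  - by rewrite lt_min; apply/andP; split; lra.
  - by rewrite ge_min lexx orbT.
  - by rewrite mulrC -ler_pdivlMr; [rewrite ge_min lexx|lra].
pose x := type_utility beta s.
have w1 := type_mass1 s0 s1.
exists (shifted_instance x a w1).
  by apply: shifted_instance_cube; exact: type_utility01.
(* Offset 2 is candidate b, with utility 10s * 9/10 + 9s. *)
have best : 18 * s <= max_util (shifted_instance x a w1).
  apply: le_trans (le_bigmax _ _ (a + o2)).
  rewrite util_shifted_instance.
  rewrite (sum_type_mass s0 s1 (fun k => x k (a + o2 - a))).
  by rewrite [a + o2]addrC addrK /x /type_utility /=; lra.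
have best0 : 0 < max_util (shifted_instance x a w1).
  by apply: lt_le_trans best; rewrite mulr_gt0.
(* Candidate [a] has utility at most 24s/beta. With an error of 4s/beta the ratio is still at least
   (18/28) beta, and 18/28 exceeds 5/8. *)
have e0 : 0 < 4 * s / beta by apply: divr_gt0; lra.
have := util_rule_shifted_instance_near w1 (type_utility01 beta400 s0 s1)
  rho_gt0 fa (type_win_prob_bounds beta400 s0 s1 srho) e0.
rewrite (sum_type_mass s0 s1 (fun k => type_utility beta s k 0)) => near.
apply: limn_esup_ge; apply: filterS near => n; rewrite -/x.
move: (util_rule _ _ _ _) (max_util _) best best0.
move=> U M best best0 /andP[U0 U1].
(* For [U] equal to 0 the ratio is infinite, as [M] is positive. *)
rewrite /Defs.ratio; have [_|UN0] := eqVneq U 0; first by rewrite gt_eqF ?leey.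
have {}U0 : 0 < U by rewrite lt0r UN0.
rewrite lee_fin ler_pdivlMr//; apply: le_trans best.
have UB : U * beta <= 28 * s.
  rewrite -ler_pdivlMr; last by lra.
  apply: (le_trans U1); rewrite /x /type_utility /= !mulr0 !add0r.
  have : 0 <= 19 * s * (s / beta) by apply: mulr_ge0; [|apply: divr_ge0]; lra.
  by lra.
have : 0 < eps * (U * beta).
  by apply: mulr_gt0 => //; apply: mulr_gt0 => //; lra.
by lra.
Qed.
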